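(* Let $\delta\in(0,1)$ and $\alpha\in(0,1)$. Then there exists a distribution over sparse matrices $\mathbf S\in\mathbb R^{k\times n}$ (an oblivious $\ell_1$ entrywise embedding, i.e., its distribution does not depend on the input) with \[ k=\Big(\frac d\delta\log n\Big)^{\alpha}\,\mathrm{poly}(\delta^{-1},\log n) \] such that for any $\mathbf A\in\mathbb R^{n\times d}$, \[ \Pr\Big\{\Omega(1)\|\mathbf A\|_1\le\|\mathbf S\mathbf A\|_1\le O\Big(\frac{1}{\delta\alpha}\Big)\|\mathbf A\|_1\Big\}\ge 1-\delta . \]
   Context: For a matrix $\mathbf M$, $\|\mathbf M\|_1$ denotes the entrywise $\ell_1$ norm $\sum_{i,j}|\mathbf M_{ij}|$. The constants hidden in $\Omega(\cdot)$ and $O(\cdot)$ are absolute. *)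

(* Defs.v *)
From HB Require Import structures.
From mathcomp Require Import all_boot all_order all_algebra.
From mathcomp Require Import all_classical all_reals all_analysis.

Set Implicit Arguments.
Unset Strict Implicit.
Unset Printing Implicit Defensive.

Import Order.TTheory GRing.Theory Num.Theory.
Import numFieldNormedType.Exports.

Local Open Scope classical_set_scope.
Local Open Scope ring_scope.

(* The library norm `|M| on matrices is the max norm, hence this definition. *)
Definition l1norm (R : realType) (m n : nat) (M : 'M[R]_(m, n)) : R :=
  \sum_(i < m) \sum_(j < n) `|M i j|.

Definition entry_preimages (R : realType) (m n : nat) :
    set (set 'M[R]_(m, n)) :=
  [set X | exists (i : 'I_m) (j : 'I_n) (B : set R),
    measurable B /\ X = [set M : 'M[R]_(m, n) | B (M i j)]].

(* 'M[R]_(m, n) with its Borel sigma-algebra, i.e. the one generated by the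
   entries. *)
Definition borel_mx (R : realType) (m n : nat) :=
  g_sigma_algebraType (@entry_preimages R m n).

Definition col_nnz (R : realType) (m n : nat) (M : 'M[R]_(m, n)) (j : 'I_n)
  : nat := #|[set i : 'I_m | M i j != 0]%SET|.

(* "Sparse" k x n matrices: O(log n) nonzero entries in every column, with
   constant C. *)
Definition sparse_mx (R : realType) (C : R) (m n : nat) (M : 'M[R]_(m, n)) :=
  forall j : 'I_n, (col_nnz M j)%:R <= C * ln n%:R.

(* Main.v *)
Require Import Defs.
From HB Require Import structures.
From mathcomp Require Import all_boot all_order all_algebra.
From mathcomp Require Import all_classical all_reals all_analysis.
From mathcomp Require Import ring lra zify.

Set Implicit Arguments.
Unset Strict Implicit.
Unset Printing Implicit Defensive.

Import Order.TTheory GRing.Theory Num.Theory.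
Import numFieldNormedType.Exports.

Local Open Scope classical_set_scope.
Local Open Scope ring_scope.

(** Every column of [S] has a single nonzero entry: column [i] independently picks
    a level [h] with probability [rate h] of order [t^(1 - 2h)], one of [N = t^4]
    buckets of that level, and a random sign; the entry is [+-1 / rate h].
    Consider one column [a] of [A], scaled to unit [l1] norm.

    Lower bound. The entries with [t^-(2h+2) < |a_i| <= t^-(2h)] are read off at
    level [h]. Their sampled and rescaled mass has the right mean and variance
    [O(1/t)], and collisions inside the buckets cost at most [t^3/N] in expectation.

    Upper bound. At level [h], entries above [t^(G - 2h)] are sampled with
    probability [O(t^(1 - G))], hence never in all [d] columns once [t^G] exceeds
    [poly(t) d / delta]; entries below [t^-(2h+6)] cancel by the random signs
    (second moment); the others are charged their expectation, and each entry is
    charged at [O(G)] levels only. With [t >= d^(alpha/4)] one can take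
    [G = O(1/alpha)].

    Summing over the columns, Markov's inequality concludes. *)

(** * Expectation over a finite product probability space *)

Section ProductExpectation.
Variables (R : realType) (n : nat) (O : finType) (p : O -> R).
Hypothesis p_ge0 : forall o, 0 <= p o.
Hypothesis p_sum1 : \sum_o p o = 1.

Definition mean (f : O -> R) : R := \sum_o p o * f o.

Definition prodw (w : {ffun 'I_n -> O}) : R := \prod_i p (w i).

Definition expect (f : {ffun 'I_n -> O} -> R) : R := \sum_w prodw w * f w.

Lemma prodw_ge0 w : 0 <= prodw w.
Proof. by apply: prodr_ge0 => i _. Qed.

Lemma expect_prod (F : 'I_n -> O -> R) :
  expect (fun w => \prod_i F i (w i)) = \prod_i mean (F i).
Proof.
rewrite /mean bigA_distr_bigA /=; apply: eq_bigr => w _.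
by rewrite big_split.
Qed.

Lemma mean_cst c : mean (fun=> c) = c.
Proof. by rewrite /mean -mulr_suml p_sum1 mul1r. Qed.

Lemma sum_prodw : \sum_w prodw w = 1.
Proof.
transitivity (expect (fun w => \prod_(i < n) (fun _ _ => 1 : R) i (w i))).
  by apply: eq_bigr => w _; rewrite big1 ?mulr1.
by rewrite (expect_prod (fun _ _ => 1)) big1 // => i _; rewrite mean_cst.
Qed.

Lemma expect_cst c : expect (fun=> c) = c.
Proof. by rewrite /expect -mulr_suml sum_prodw mul1r. Qed.

Lemma eq_expect f g : f =1 g -> expect f = expect g.
Proof. by move=> fg; apply: eq_bigr => w _; rewrite fg. Qed.

Lemma ler_expect f g : (forall w, f w <= g w) -> expect f <= expect g.
Proof.
move=> fg; apply: ler_sum => w _.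
by rewrite ler_wpM2l ?prodw_ge0.
Qed.

Lemma expectD f g : expect (fun w => f w + g w) = expect f + expect g.
Proof. by rewrite -big_split; apply: eq_bigr => w _; rewrite mulrDr. Qed.

Lemma expectZ c f : expect (fun w => c * f w) = c * expect f.
Proof. by rewrite mulr_sumr; apply: eq_bigr => w _; rewrite mulrCA. Qed.

Lemma expect_sum (I : Type) (r : seq I) (P : pred I)
    (F : I -> {ffun 'I_n -> O} -> R) :
  expect (fun w => \sum_(i <- r | P i) F i w) = \sum_(i <- r | P i) expect (F i).
Proof.
rewrite /expect exchange_big /=; apply: eq_bigr => w _.
by rewrite mulr_sumr.
Qed.

Lemma expect_coord i (f : O -> R) : expect (fun w => f (w i)) = mean f.
Proof.
pose F j := if j == i then f else fun=> 1.
rewrite (@eq_expect _ (fun w => \prod_j F j (w j))); last first.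
  move=> w; rewrite (bigD1 i) //= big1 ?mulr1 /F ?eqxx // => j /negPf ji.
  by rewrite ji.
rewrite expect_prod (bigD1 i) //= big1 ?mulr1 /F ?eqxx // => j /negPf ji.
by rewrite ji mean_cst.
Qed.

Lemma expect_indep i j (f g : O -> R) : i != j ->
  expect (fun w => f (w i) * g (w j)) = mean f * mean g.
Proof.
move=> ij; have ji : (j == i) = false by rewrite eq_sym (negPf ij).
pose F l := if l == i then f else if l == j then g else fun=> 1.
rewrite (@eq_expect _ (fun w => \prod_l F l (w l))); last first.
  move=> w; rewrite (bigD1 i) //= (bigD1 j) /= ?ji // big1 ?mulr1 /F ?eqxx ?ji //.
  by move=> l /andP[/negPf -> /negPf ->].
rewrite expect_prod (bigD1 i) //= (bigD1 j) /= ?ji //.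
rewrite big1 ?mulr1 /F ?eqxx ?ji //.
by move=> l /andP[/negPf -> /negPf ->]; rewrite mean_cst.
Qed.

(** By independence each cross term factors into two means, both zero. *)
Lemma expect_sqr_sum (y : 'I_n -> O -> R) : (forall i, mean (y i) = 0) ->
  expect (fun w => (\sum_i y i (w i)) ^+ 2) = \sum_i mean (fun o => y i o ^+ 2).
Proof.
move=> y0.
rewrite (@eq_expect _ (fun w => \sum_i \sum_j y i (w i) * y j (w j))); last first.
  by move=> w; rewrite expr2 big_distrlr.
rewrite expect_sum; apply: eq_bigr => i _.
rewrite expect_sum (bigD1 i) //= big1 ?addr0.
  by rewrite -(expect_coord i); apply: eq_expect => w; rewrite expr2.
by move=> j ji; rewrite expect_indep 1?eq_sym // y0 mul0r.
Qed.

(** Average [(c |f| - 1)^2 >= 0]. The tunable [c] plays the role of Cauchy-Schwarz without any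
    square root of a second moment. *)
Lemma expect_norm_le (c : R) (f : {ffun 'I_n -> O} -> R) : 0 < c ->
  expect (fun w => `|f w|) <= 2^-1 * (c * expect (fun w => f w ^+ 2) + c^-1).
Proof.
move=> c0; rewrite -(expect_cst c^-1) -expectZ -expectD -expectZ.
apply: ler_expect => w; rewrite -[f w ^+ 2]real_normK ?num_real //.
have cV : c * c^-1 = 1 by rewrite divff // gt_eqF.
have := sqr_ge0 (c * `|f w| - 1); rewrite -(@pmulr_lge0 _ c^-1) ?invr_gt0 //.
have -> : (c * `|f w| - 1) ^+ 2 * c^-1 = (c * c^-1) * c * `|f w| ^+ 2
    - 2 * (c * c^-1) * `|f w| + c^-1 by ring.
rewrite cV; lra.
Qed.

Lemma markov_expect (c : R) (f : {ffun 'I_n -> O} -> R) : 0 < c -> (forall w, 0 <= f w) ->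
  expect (fun w => (c < f w)%R%:R) <= expect f / c.
Proof.
move=> c0 f0; rewrite mulrC -expectZ; apply: ler_expect => w.
case: ltP => [cf|_] /=; last by rewrite mulr_ge0 // invr_ge0 ltW.
by rewrite mulrC ler_pdivlMr // mul1r ltW.
Qed.

End ProductExpectation.

(** * Sampling rates and size levels *)

Lemma sum_nat_window (h0 L M : nat) :
  (\sum_(h < M) (h0 <= h < h0 + L)%N <= L)%N.
Proof.
(* The exact count, unlike the bound, carries an induction on [M]. *)
suff -> : (\sum_(h < M) (h0 <= h < h0 + L)%N = minn M (h0 + L) - minn M h0)%N.
  by lia.
elim: M => [|M IH]; first by rewrite big_ord0; lia.
by rewrite big_ord_recr /= IH; lia.
Qed.

Section Rates.
Variables (R : realType) (t : R) (H : nat).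
Hypothesis t_ge4 : 4 <= t.

(** Level [0] receives the probability left over by levels [1] to [H]. Beyond [H] the rate is [0],
    so surplus rows are never drawn, and [(rate h)^-1 = 0] removes them from rescaled sums. *)
Definition rate (h : nat) : R :=
  if h == 0 then 1 - \sum_(l < H) t / t ^+ l.+1.*2
  else if (h <= H)%N then t / t ^+ h.*2 else 0.

Let t_gt0 : 0 < t. Proof. by apply: lt_le_trans t_ge4. Qed.
Let t_ge1 : 1 <= t. Proof. by apply: le_trans t_ge4; rewrite ler1n. Qed.
Let tX_gt0 m : 0 < t ^+ m. Proof. exact: exprn_gt0. Qed.
Let tX_neq0 m : t ^+ m != 0. Proof. by rewrite gt_eqF. Qed.

Lemma rate_sum : \sum_(h < H.+1) rate h = 1.
Proof.
rewrite big_ord_recl /= (eq_bigr (fun l : 'I_H => t / t ^+ l.+1.*2)); last first.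
  by move=> l _; rewrite /rate /= ltn_ord.
by rewrite /rate /= subrK.
Qed.

Lemma geometric_sum_le M : \sum_(l < M) t / t ^+ l.+1.*2 <= 2 / t.
Proof.
(* The slack [t^(-2M)] makes the bound inductive. *)
suff : \sum_(l < M) t / t ^+ l.+1.*2 <= 2 / t * (1 - (t ^+ M.*2)^-1).
  move/le_trans; apply; rewrite ler_piMr ?divr_ge0 ?ltW //.
  by rewrite ltrBlDr ltrDl invr_gt0.
elim: M => [|M IH]; first by rewrite big_ord0 expr0 invr1 subrr mulr0.
rewrite big_ord_recr /=; apply: le_trans (lerD IH (lexx _)) _.
rewrite -subr_ge0 doubleS !exprS.
have -> : 2 / t * (1 - (t * (t * t ^+ M.*2))^-1) -
   (2 / t * (1 - (t ^+ M.*2)^-1) + t / (t * (t * t ^+ M.*2))) =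
   (t ^+ 2 - 2) / (t ^+ 3 * t ^+ M.*2).
  by field; rewrite tX_neq0 gt_eqF.
rewrite divr_ge0 ?mulr_ge0 ?ltW //.
have := mulr_ge0 (ltW t_gt0) (ltW t_gt0); have := t_ge4; nra.
Qed.

Lemma rate0_ge : 1 - 2 / t <= rate 0.
Proof. by rewrite /rate eqxx lerB // geometric_sum_le. Qed.

Lemma rate0_le1 : rate 0 <= 1.
Proof.
by rewrite /rate eqxx gerBl sumr_ge0 // => l _; rewrite divr_ge0 ?ltW.
Qed.

Lemma rate0_ge_half : 2^-1 <= rate 0.
Proof.
apply: le_trans rate0_ge; suff : 2 / t <= 2^-1 by lra.
by rewrite ler_pdivrMr //; have := t_ge4; lra.
Qed.

Lemma rate_gt0 h : (h <= H)%N -> 0 < rate h.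
Proof.
case: h => [|h] hH; first by apply: lt_le_trans rate0_ge_half.
by rewrite /rate /= hH divr_gt0.
Qed.

Lemma rate_gtH h : (H < h)%N -> rate h = 0.
Proof. by case: h => // h Hh; rewrite /rate /= leqNgt Hh. Qed.

Lemma rate_ge0 h : 0 <= rate h.
Proof. by case: (leqP h H) => hH; [rewrite ltW // rate_gt0 | rewrite rate_gtH]. Qed.

Lemma rate_mul_le h : rate h * t ^+ h.*2 <= t.
Proof.
case: (leqP h H) => hH; last by rewrite rate_gtH // mul0r ltW.
case: h hH => [_|h hH].
  by rewrite expr0 mulr1 (le_trans rate0_le1).
by rewrite /rate /= hH divfK.
Qed.

Lemma rate_inv_le h : (h <= H)%N -> (rate h)^-1 <= 2 * t ^+ h.*2.
Proof.
case: h => [_|h hH].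
  rewrite expr0 mulr1 -[2]invrK lef_pV2 ?posrE ?rate_gt0 ?invr_gt0 //.
  exact: rate0_ge_half.
rewrite /rate /= hH invf_div ler_pdivrMr //.
rewrite mulrAC -[X in X <= _]mul1r ler_wpM2r ?ltW //.
by have := t_ge4; lra.
Qed.

(** The left-hand side is the variance of an entry [x] kept with probability [rate h] and divided by
    it. For [h > 0] the scale bound gives [x / rate h <= 1 / t]; at level [0] the [- 1] is
    essential, and [rate 0 >= 1 - 2 / t] suffices. *)
Lemma rate_var_le h (x : R) : (h <= H)%N -> 0 <= x -> x * t ^+ h.*2 <= 1 ->
  x ^+ 2 * ((rate h)^-1 - 1) <= x * (4 / t).
Proof.
move=> hH x0; rewrite expr2 -mulrA => xt; apply: ler_wpM2l => //.
case: h hH xt => [_|h hH xt].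
  rewrite expr0 mulr1 => x1.
  have r0 : 0 < rate 0 by exact: rate_gt0.
  apply: (@le_trans _ _ ((rate 0)^-1 - 1)).
    by rewrite ler_piMl // subr_ge0 invf_ge1 // rate0_le1.
  rewrite lerBlDr -[X in X <= _]mul1r ler_pdivrMr //.
  have y4 : t^-1 <= 4^-1 by rewrite lef_pV2 ?posrE.
  have y0 : 0 <= t^-1 by rewrite invr_ge0 ltW.
  apply: le_trans (ler_wpM2l _ rate0_ge); last by rewrite addr_ge0 ?mulr_ge0.
  by nra.
rewrite /rate /= hH invf_div mulrBr mulr1.
apply: (@le_trans _ _ (t^-1)); last first.
  have : 0 <= t^-1 by rewrite invr_ge0 ltW.
  by lra.
apply: (@le_trans _ _ (x * (t ^+ h.+1.*2 / t))); first by rewrite gerBl.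
by rewrite mulrA ler_piMl // invr_ge0 ltW.
Qed.

(** Level [h] owns the [N] consecutive rows with quotient [h] by [N]; rows from [H.+1 * N] on lie
    above level [H], where [F] vanishes. *)
Lemma sum_rows (k N : nat) (F : nat -> R) : (0 < N)%N -> (H.+1 * N <= k)%N ->
  (forall h, (H < h)%N -> F h = 0) ->
  \sum_(r < k) F (r %/ N)%N = N%:R * \sum_(h < H.+1) F h.
Proof.
move=> N0 Nk F0.
rewrite -(big_mkord xpredT (fun r => F (r %/ N)%N)).
rewrite (big_cat_nat _ Nk) //= [X in _ + X]big_nat_cond [X in _ + X]big1 ?addr0; last first.
  by move=> r /andP[/andP[rH _] _]; rewrite F0 // leq_divRL.
elim: H.+1 => [|M IH]; first by rewrite mul0n big_geq // big_ord0 mulr0.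
rewrite mulSn addnC (big_cat_nat _ (leq_addr _ _)) //= IH big_ord_recr /= mulrDr.
congr (_ + _); rewrite -{1}[(M * N)%N]add0n big_addn addKn.
rewrite big_mkord (eq_bigr (fun=> F M)); last first.
  by move=> i _; rewrite addnC divnMDl // divn_small // addn0.
by rewrite sumr_const card_ord mulr_natl.
Qed.

(* The value [H.+1] marks the [x] too small for every level. *)
Definition size_level (x : R) : nat :=
  find (fun h => 1 < x * t ^+ h.+1.*2) (iota 0 H.+1).

Lemma size_level_le x : (size_level x <= H.+1)%N.
Proof. by rewrite /size_level -[X in (_ <= X)%N](size_iota 0 H.+1) find_size. Qed.

Lemma size_level_gt x : (size_level x <= H)%N ->
  1 < x * t ^+ (size_level x).+1.*2.
Proof.
move=> lH.
have hs : has (fun h => 1 < x * t ^+ h.+1.*2) (iota 0 H.+1).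
  by rewrite has_find size_iota ltnS.
by have := nth_find 0 hs; rewrite nth_iota // ltnS.
Qed.

Lemma size_level_mul_le1 (x : R) : x <= 1 -> x * t ^+ (size_level x).*2 <= 1.
Proof.
move=> x1; have := size_level_le x.
case E : (size_level x) => [|h] hH; first by rewrite expr0 mulr1.
have hl : (h < size_level x)%N by rewrite E.
have := before_find 0 hl; rewrite nth_iota // add0n => /negbT.
by rewrite -leNgt.
Qed.

(** Let [h0] be the first level with [1 < x * t^(2 h0 + 6)]. From [h0 + G + 6] on, [x * t^(2h)]
    exceeds [t^G], so the counted levels lie in a window of length [G + 6]. *)
Lemma level_count_le (x : R) G : 0 <= x ->
  \sum_(h < H.+1) ((1 < x * t ^+ (h.*2 + 6))%R && (x * t ^+ h.*2 <= t ^+ G)%R)%:R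
   <= (G + 6)%:R :> R.
Proof.
move=> x0; pose P h := 1 < x * t ^+ (h.*2 + 6).
have [exP|nP] := pselect (exists h, P h); last first.
  rewrite big1 // => h _; case: ltP => //= hP.
  by case: nP; exists (h : nat).
pose h0 := ex_minn exP.
have [Ph0 minh0] : P h0 /\ forall h, P h -> (h0 <= h)%N.
  by rewrite /h0; case: ex_minnP.
apply: (@le_trans _ _ (\sum_(h < H.+1) (h0 <= h < h0 + (G + 6))%N%:R)).
  apply: ler_sum => h _; case: (boolP (P h)) => Ph; rewrite /P in Ph *; last first.
    by rewrite (negPf Ph).
  rewrite Ph /= minh0 //=; case: (leP (x * t ^+ h.*2) (t ^+ G)) => //= xG.
  suff -> : (h < h0 + (G + 6))%N by [].
  rewrite ltnNge; apply/negP => hh.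
  move: Ph0; rewrite /P ltNge => /negP; apply.
  rewrite -(ler_pM2r (tX_gt0 G)) mul1r; apply: le_trans xG.
  rewrite -mulrA -exprD ler_wpM2l // ler_eXn2l //; first lia.
  by have := t_ge4; lra.
by rewrite -natr_sum ler_nat sum_nat_window.
Qed.

End Rates.

(* If two entries of size above [1 / u] collide, the left-hand side is
   nonpositive; otherwise its sum has a single term. *)
Lemma bucket_lower (R : realType) (I : finType) (B Q : pred I) (y : I -> R) (u : R) :
  0 <= u -> (forall i, B i -> Q i -> 1 < `|y i| * u) ->
  \sum_(i | B i && Q i) (`|y i| - u * \sum_(j | B j && (j != i)) `|y i| * `|y j|)
   <= `|\sum_(i | B i) y i|.
Proof.
move=> u0 yu; pose S i := \sum_(j | B j && (j != i)) `|y j|.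
rewrite (eq_bigr (fun i => `|y i| * (1 - u * S i))); last first.
  by move=> i _; rewrite -mulr_sumr mulrBr mulr1 mulrCA.
have [[i0 [Bi Qi uS]]|none] := pselect (exists i, [/\ B i, Q i & u * S i < 1]).
  rewrite (bigD1 i0) /= ?Bi //= big1 ?addr0; last first.
    move=> i /andP[/andP[Bi' Qi'] ii0].
    suff : 1 < u * S i0 by rewrite ltNge (ltW uS).
    apply: lt_le_trans (yu _ Bi' Qi') _; rewrite mulrC ler_wpM2l //.
    by rewrite /S (bigD1 i) /= ?Bi' // lerDl sumr_ge0.
  rewrite (bigD1 i0) //=; apply: le_trans (lerB_normD _ _).
  apply: (@le_trans _ _ (`|y i0| - S i0)); last first.
    by rewrite lerB // ler_norm_sum.
  have S0 : 0 <= S i0 by rewrite sumr_ge0.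
  have := yu _ Bi Qi; nra.
apply: le_trans (normr_ge0 _); apply: sumr_le0 => i /andP[Bi Qi].
rewrite mulr_ge0_le0 // subr_le0 leNgt; apply/negP => uS.
by case: none; exists i.
Qed.

(** * The random sketch: one row and one sign per coordinate *)

Section Sketch.
Variables (R : realType) (s t : R) (N H k n : nat).
Hypothesis s_ge2 : 2 <= s.
Hypothesis tE : t = s ^+ 2.
Hypothesis NE : N%:R = t ^+ 4.
Hypothesis rows_le : (H.+1 * N <= k)%N.

Let s_gt0 : 0 < s. Proof. by apply: lt_le_trans s_ge2. Qed.
Let t_ge4 : 4 <= t. Proof. by rewrite tE; have := s_ge2; nra. Qed.
Let t_gt0 : 0 < t. Proof. by apply: lt_le_trans t_ge4. Qed.
Let tX_gt0 m : 0 < t ^+ m. Proof. exact: exprn_gt0. Qed.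
Let NR_gt0 : 0 < N%:R :> R. Proof. by rewrite NE. Qed.
Let N_gt0 : (0 < N)%N. Proof. by rewrite -(ltr0n R). Qed.

Local Notation rt := (rate t H).
Local Notation lv := (size_level t H).

Definition row_level (r : 'I_k) : nat := (r %/ N)%N.

Definition row_prob (r : 'I_k) : R := rt (row_level r) / N%:R.

Definition outcome_prob (o : 'I_k * bool) : R := row_prob o.1 / 2.

Local Notation E := (@expect R n _ outcome_prob).
Local Notation mean1 := (mean outcome_prob).
Local Notation Omega := {ffun 'I_n -> 'I_k * bool}.

Lemma row_prob_ge0 r : 0 <= row_prob r.
Proof. by rewrite divr_ge0 // rate_ge0. Qed.

Lemma outcome_prob_ge0 o : 0 <= outcome_prob o.
Proof. by rewrite divr_ge0 // row_prob_ge0. Qed.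

Lemma mean_outcome f :
  mean1 f = \sum_r row_prob r * ((f (r, true) + f (r, false)) / 2).
Proof.
rewrite /mean (eq_bigr (fun o => outcome_prob (o.1, o.2) * f (o.1, o.2))); last first.
  by case.
rewrite -(pair_bigA _ (fun r b => outcome_prob (r, b) * f (r, b))) /=.
by apply: eq_bigr => r _; rewrite big_bool /outcome_prob /=; field.
Qed.

Lemma mean_level (f : nat -> R) :
  mean1 (fun o => f (row_level o.1)) = \sum_(h < H.+1) rt h * f h.
Proof.
pose F h := rt h / N%:R * f h.
rewrite mean_outcome (eq_bigr (fun r : 'I_k => F (r %/ N)%N)); last first.
  by move=> r _; congr (_ * _) => /=; rewrite /row_level; lra.
rewrite (@sum_rows _ H) //; last by move=> h hH; rewrite /F rate_gtH ?mul0r.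
rewrite mulr_sumr; apply: eq_bigr => h _.
by rewrite /F mulrA mulrCA divff ?gt_eqF ?mulr1.
Qed.

Lemma outcome_prob_sum1 : \sum_o outcome_prob o = 1.
Proof.
have := mean_level (fun=> 1); rewrite /mean.
under eq_bigr do rewrite mulr1.
by under [in X in _ = X -> _]eq_bigr do rewrite mulr1; rewrite rate_sum.
Qed.

Lemma mean_hit r : mean1 (fun o => (o.1 == r)%:R) = row_prob r.
Proof.
rewrite mean_outcome (bigD1 r) //= eqxx big1 ?addr0; first by rewrite -[true%:R]/(1 : R); lra.
by move=> r' /negPf -> /=; rewrite addr0 mul0r mulr0.
Qed.

Lemma mean_signed_hit r c : mean1 (fun o => (o.1 == r)%:R * (-1) ^+ o.2 * c) = 0.
Proof.
by rewrite mean_outcome big1 // => r' _ /=; rewrite expr1 expr0; ring.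
Qed.

Definition sketch (w : Omega) : 'M[R]_(k, n) :=
  \matrix_(r, i) (((w i).1 == r)%:R * (-1) ^+ (w i).2 / rt (row_level r)).

(** * One column [a]: lower bound on the sketched norm *)

Variable a : 'I_n -> R.
Hypothesis a_sum : \sum_i `|a i| <= 1.

Definition bucket r (P : pred 'I_n) (w : Omega) : R :=
  \sum_(i | P i) ((w i).1 == r)%:R * (-1) ^+ (w i).2 * a i.

(** The [l1] norm of [sketch w] applied to [a], with the rescaling factor taken out of each row. *)
Definition sketch_norm (w : Omega) : R :=
  \sum_r (rt (row_level r))^-1 * `|bucket r xpredT w|.

Let a_le1 i : `|a i| <= 1.
Proof. by apply: le_trans a_sum; rewrite (bigD1 i) //= lerDl sumr_ge0. Qed.

(* If [lv `|a i| = H.+1] this is [0], because [rate] vanishes there. *)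
Definition sampled i (o : 'I_k * bool) : R :=
  (row_level o.1 == lv `|a i|)%:R * (`|a i| / rt (lv `|a i|)).

Definition sampled_mass (w : Omega) : R := \sum_i sampled i (w i).

Definition collision r (w : Omega) : R :=
  \sum_(i | lv `|a i| == row_level r) \sum_(j | j != i)
    `|a i| * `|a j| * (((w i).1 == r)%:R * ((w j).1 == r)%:R).

Definition penalty (w : Omega) : R :=
  \sum_r (rt (row_level r))^-1 * t ^+ (row_level r).+1.*2 * collision r w.

Lemma collision_ge0 r w : 0 <= collision r w.
Proof.
apply: sumr_ge0 => i _; apply: sumr_ge0 => j _.
by rewrite mulr_ge0 ?(mulr_ge0 (normr_ge0 _)) ?mulr_ge0.
Qed.

Lemma penalty_ge0 w : 0 <= penalty w.
Proof.
apply: sumr_ge0 => r _.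
apply: mulr_ge0; last exact: collision_ge0.
by rewrite mulr_ge0 ?invr_ge0 ?rate_ge0 ?(ltW (tX_gt0 _)).
Qed.

Lemma sampled_massE w : sampled_mass w =
  \sum_r (rt (row_level r))^-1 *
    \sum_(i | lv `|a i| == row_level r) ((w i).1 == r)%:R * `|a i|.
Proof.
under eq_bigr do rewrite mulr_sumr big_mkcond.
rewrite exchange_big /=; apply: eq_bigr => i _.
rewrite (bigD1 (w i).1) //= eqxx big1 ?addr0; last first.
  move=> r /negPf rw; case: ifP => // _.
  by rewrite eq_sym rw mul0r mulr0.
rewrite /sampled eq_sym; case: eqP => [->|_] /=; last by rewrite mul0r.
by rewrite !mul1r mulrC.
Qed.

(** Apply [bucket_lower] in each row of level [h], with [Q] the entries of size level [h] and
    [u = t^(2h + 2)]; [size_level_gt] says that these entries exceed [1 / u]. *)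
Lemma sketch_norm_lower w : sampled_mass w - penalty w <= sketch_norm w.
Proof.
rewrite sampled_massE /penalty /sketch_norm -sumrB; apply: ler_sum => r _.
(* In surplus rows [0^-1 = 0] makes both sides vanish. *)
case: (leqP (row_level r) H) => rH; last first.
  by rewrite rate_gtH // invr0 !mul0r subrr.
rewrite -mulrA -mulrBr ler_wpM2l ?invr_ge0 ?rate_ge0 //.
set u := t ^+ _.
pose B i := (w i).1 == r; pose y i := (-1) ^+ (w i).2 * a i.
have ny i : `|y i| = `|a i| by rewrite /y normrM normrX normrN1 expr1n mul1r.
have -> : bucket r xpredT w = \sum_(i | B i) y i.
  rewrite /bucket [RHS]big_mkcond; apply: eq_bigr => i _.
  by rewrite /B /y; case: eqP; rewrite /= ?mul1r ?mul0r.
apply: le_trans (@bucket_lower _ _ B (fun i => lv `|a i| == row_level r) y u _ _).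
- rewrite /collision mulr_sumr -sumrB big_mkcond [leRHS]big_mkcond /=.
  apply: ler_sum => i _; rewrite /B andbC; case: eqP => //= li.
  case: eqP => [wi|_] /=; last first.
    rewrite mul0r big1 ?mulr0 ?subrr // => j _.
    by rewrite mul0r mulr0.
  rewrite ny mul1r lerB // ler_wpM2l ?(ltW (tX_gt0 _)) // big_mkcond [leRHS]big_mkcond /=.
  apply: ler_sum => j _; rewrite ny; case: eqP => //= [_|wj].
    by case: ifP => // _; rewrite !mulr1.
  by case: ifP => // _; rewrite mulr0 mulr0.
- exact: (ltW (tX_gt0 _)).
- move=> i _ /eqP li; rewrite ny /u -li.
  by apply: size_level_gt; rewrite li.
Qed.

(** Two distinct coordinates fall in row [r] independently, each with probability [row_prob r]; the
    factors [|a_j|] then sum to at most [1]. *)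
Lemma expect_collision_le r : E (collision r) <=
  row_prob r ^+ 2 * \sum_(i | lv `|a i| == row_level r) `|a i|.
Proof.
rewrite /collision expect_sum mulr_sumr; apply: ler_sum => i _.
rewrite expect_sum.
apply: (@le_trans _ _ (\sum_(j | j != i) row_prob r ^+ 2 * `|a i| * `|a j|)).
  apply: ler_sum => j ji; rewrite expectZ (expect_indep outcome_prob_sum1
    (fun o => (o.1 == r)%:R) (fun o => (o.1 == r)%:R)) 1?eq_sym //.
  by rewrite !mean_hit expr2 mulrC mulrA.
rewrite -mulr_sumr ler_piMr ?(mulr_ge0 (sqr_ge0 _)) //.
by apply: le_trans a_sum; rewrite [leRHS](bigD1 i) //= lerDr.
Qed.

(** The [N] rows of level [h] contribute at most [rate h * t^(2h) * t^2 / N <= t^3 / N] times the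
    mass of the entries of size level [h]. With [N = t^4] this factor is [1 / t], and each entry has
    only one size level. *)
Lemma expect_penalty_le : E penalty <= t^-1.
Proof.
rewrite /penalty expect_sum.
pose F h := (rt h)^-1 * t ^+ h.+1.*2 * ((rt h / N%:R) ^+ 2 *
  \sum_(i | lv `|a i| == h) `|a i|).
apply: (@le_trans _ _ (\sum_(r < k) F (r %/ N)%N)).
  apply: ler_sum => r _; rewrite expectZ ler_wpM2l ?expect_collision_le //.
  by rewrite mulr_ge0 ?invr_ge0 ?rate_ge0 ?(ltW (tX_gt0 _)).
rewrite (@sum_rows _ H) //; last first.
  by move=> h hH; rewrite /F rate_gtH // invr0 !mul0r.
rewrite mulr_sumr.
apply: (@le_trans _ _ (\sum_(h < H.+1) t^-1 * \sum_(i | lv `|a i| == h) `|a i|)).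
  apply: ler_sum => h _; rewrite /F.
  have r0 : 0 < rt h by apply: rate_gt0 => //; rewrite -ltnS ltn_ord.
  rewrite (mulrA _ (_ ^+ 2)) mulrA; apply: ler_wpM2r; first exact: sumr_ge0.
  have -> : N%:R * ((rt h)^-1 * t ^+ h.+1.*2 * (rt h / N%:R) ^+ 2) =
      (rt h * t ^+ h.*2) * t ^+ 2 / N%:R.
    by rewrite doubleS !exprS; field; rewrite !gt_eqF.
  have := rate_mul_le H t_ge4 h; set z := rt h * _ => zt.
  rewrite NE; apply: (@le_trans _ _ (t * t ^+ 2 / t ^+ 4)).
    by rewrite ler_wpM2r ?invr_ge0 ?(ltW (tX_gt0 _)) // ler_wpM2r ?(ltW (tX_gt0 _)).
  by rewrite le_eqVlt; apply/predU1P; left; field; rewrite gt_eqF.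
rewrite -mulr_sumr ler_piMr ?invr_ge0 ?(ltW t_gt0) //; apply: le_trans a_sum.
under eq_bigr do rewrite big_mkcond; rewrite exchange_big /=.
apply: ler_sum => i _; rewrite -big_mkcond /=.
have [lH|lH] := leqP (lv `|a i|) H.
  by rewrite (big_pred1 (Ordinal (lH : (_ < H.+1)%N))) // => h; rewrite eq_sym.
rewrite big1 // => h /eqP li; move: lH; rewrite li ltnNge -ltnS.
by have := ltn_ord h; lia.
Qed.

(** The mean of [sampled i]: an entry too small for every level is never read off. *)
Definition live_mass i : R := if (lv `|a i| <= H)%N then `|a i| else 0.

Lemma sum_level_delta (l : nat) (c : R) : (l <= H)%N ->
  \sum_(h < H.+1) rt h * ((h == l :> nat)%:R * c) = rt l * c.
Proof.
move=> lH; rewrite (bigD1 (Ordinal (lH : (l < H.+1)%N))) //= eqxx mul1r big1 ?addr0 //.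
move=> h; rewrite -val_eqE /= => /negPf ->.
by rewrite mul0r mulr0.
Qed.

Lemma mean_sampled i : mean1 (sampled i) = live_mass i.
Proof.
rewrite /sampled (mean_level (fun h => (h == lv `|a i|)%:R * (`|a i| / rt (lv `|a i|)))).
rewrite /live_mass; case: leqP => lH.
  rewrite sum_level_delta //; field.
  by rewrite gt_eqF // rate_gt0.
by rewrite (rate_gtH _ lH) big1 // => h _; rewrite invr0 !mulr0.
Qed.

Lemma mean_sampled_sqr i :
  mean1 (fun o => sampled i o ^+ 2) = `|a i| * live_mass i / rt (lv `|a i|).
Proof.
rewrite /sampled (mean_level (fun h => ((h == lv `|a i|)%:R *
   (`|a i| / rt (lv `|a i|))) ^+ 2)).
rewrite (eq_bigr (fun h : 'I_H.+1 => rt h * ((h == lv `|a i| :> nat)%:R *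
   (`|a i| / rt (lv `|a i|)) ^+ 2))); last first.
  by move=> h _; rewrite exprMn -natrX; case: eqP.
rewrite /live_mass; case: leqP => lH.
  rewrite sum_level_delta //; field.
  by rewrite gt_eqF // rate_gt0.
by rewrite mulr0 mul0r big1 // => h _; rewrite (rate_gtH _ lH) invr0 mulr0 expr0n !mulr0.
Qed.

(** The variance is at most [4 / t], so [expect_norm_le] with [c = s], the square root of [t], gives
    half of [4 / s + 1 / s]. *)
Lemma expect_sampled_dev_le :
  E (fun w => `|sampled_mass w - \sum_i live_mass i|) <= 5 / 2 / s.
Proof.
apply: le_trans (expect_norm_le outcome_prob_ge0 outcome_prob_sum1 _ s_gt0) _.
pose y i o := sampled i o - live_mass i.
rewrite (@eq_expect _ _ _ _ _ (fun w => (\sum_i y i (w i)) ^+ 2)); last first.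
  by move=> w; rewrite /y sumrB.
have mB f c : mean1 (fun o => f o - c) = mean1 f - c.
  rewrite -[in RHS](mean_cst outcome_prob_sum1 c) /mean -sumrB.
  by apply: eq_bigr => o _; rewrite mulrBr.
rewrite (expect_sqr_sum outcome_prob_sum1); last first.
  by move=> i; rewrite /y mB mean_sampled subrr.
have var i : mean1 (fun o => y i o ^+ 2) <= `|a i| * (4 / t).
  have -> : mean1 (fun o => y i o ^+ 2) = mean1 (fun o => sampled i o ^+ 2) - live_mass i ^+ 2.
    transitivity (mean1 (fun o => sampled i o ^+ 2 - 2 * live_mass i * sampled i o) + live_mass i ^+ 2).
      rewrite -[X in _ = _ + X](mean_cst outcome_prob_sum1) /mean -big_split /=.
      by apply: eq_bigr => o _; rewrite /y; ring.
    have -> : mean1 (fun o => sampled i o ^+ 2 - 2 * live_mass i * sampled i o) =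
       mean1 (fun o => sampled i o ^+ 2) - 2 * live_mass i * mean1 (sampled i).
      by rewrite /mean mulr_sumr -sumrB; apply: eq_bigr => o _; ring.
    by rewrite mean_sampled; ring.
  rewrite mean_sampled_sqr /live_mass; case: leqP => lH; last first.
    by rewrite mulr0 mul0r expr0n subrr mulr_ge0 // divr_ge0 // ltW.
  have := rate_var_le t_ge4 lH (normr_ge0 (a i)) (size_level_mul_le1 t H (a_le1 i)).
  by apply: le_trans; rewrite le_eqVlt; apply/predU1P; left; ring.
have V : \sum_i mean1 (fun o => y i o ^+ 2) <= 4 / t.
  apply: le_trans (ler_sum _ (fun i _ => var i)) _.
  by rewrite -mulr_suml ler_piMl // divr_ge0 // ltW.
apply: (@le_trans _ _ (2^-1 * (s * (4 / t) + s^-1))).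
  by rewrite ler_wpM2l ?invr_ge0 // lerD2r ler_wpM2l // ltW.
by rewrite le_eqVlt; apply/predU1P; left; rewrite tE; field; rewrite gt_eqF.
Qed.

Hypothesis n_le : n%:R <= t ^+ H.

(** Each lost entry is at most [t^-(H + 1)], and there are at most [n <= t^H] of them. *)
Lemma live_mass_ge : \sum_i `|a i| - t^-1 <= \sum_i live_mass i.
Proof.
rewrite lerBlDr -lerBlDl -sumrB.
apply: (@le_trans _ _ (\sum_(i < n) (t ^+ H.+1)^-1)).
  apply: ler_sum => i _; rewrite /live_mass; case: leqP => lH.
    by rewrite subrr invr_ge0 ltW.
  rewrite subr0; have := size_level_mul_le1 t H (a_le1 i).
  have -> : lv `|a i| = H.+1 by apply/eqP; rewrite eqn_leq size_level_le.
  rewrite -ler_pdivlMr // mul1r => /le_trans; apply.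
  rewrite lef_pV2 ?posrE // ler_eXn2l; last by have := t_ge4; lra.
  by rewrite -addnn leq_addr.
rewrite sumr_const card_ord -mulr_natl exprS invfM mulrCA ler_piMr ?invr_ge0 ?(ltW t_gt0) //.
by rewrite ler_pdivrMr // mul1r.
Qed.

Definition deficit (w : Omega) : R :=
  `|sampled_mass w - \sum_i live_mass i| + penalty w + t^-1.

Lemma deficit_ge0 w : 0 <= deficit w.
Proof. by rewrite !addr_ge0 ?penalty_ge0 // invr_ge0 ltW. Qed.

Lemma sketch_norm_ge w : \sum_i `|a i| - deficit w <= sketch_norm w.
Proof.
apply: le_trans (sketch_norm_lower w); rewrite /deficit.
have := live_mass_ge; have := ler_norm (- (sampled_mass w - \sum_i live_mass i)).
by rewrite normrN; lra.
Qed.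

Lemma expect_deficit_le : E deficit <= 5 / s.
Proof.
rewrite /deficit expectD expectD expect_cst ?outcome_prob_sum1 //.
have := expect_sampled_dev_le; have := expect_penalty_le.
have : t^-1 <= 2^-1 * s^-1.
  by rewrite tE expr2 invfM ler_wpM2r ?invr_ge0 ?(ltW s_gt0) // lef_pV2 ?posrE.
have : 0 <= s^-1 :> R by rewrite invr_ge0 ltW.
lra.
Qed.

(** * One column: upper bound on the sketched norm *)

Variable G : nat.

Definition is_big h i := t ^+ G < `|a i| * t ^+ h.*2.
Definition is_small h i := `|a i| * t ^+ (h.*2 + 6) <= 1.
Definition is_mid h i := ~~ is_small h i && ~~ is_big h i.

Definition overload (w : Omega) : bool :=
  [exists i, is_big (row_level (w i).1) i].

Definition mid_load r (w : Omega) : R :=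
  \sum_(i | is_mid (row_level r) i) `|a i| * ((w i).1 == r)%:R.

Definition excess (w : Omega) : R :=
  \sum_r (rt (row_level r))^-1 *
    (`|bucket r (is_small (row_level r)) w| + mid_load r w).

Lemma mid_load_ge0 r w : 0 <= mid_load r w.
Proof. by apply: sumr_ge0 => i _; rewrite mulr_ge0. Qed.

Lemma excess_ge0 w : 0 <= excess w.
Proof.
apply: sumr_ge0 => r _; apply: mulr_ge0; first by rewrite invr_ge0 rate_ge0.
by rewrite addr_ge0 ?mid_load_ge0.
Qed.

(** Without overload no big entry reaches a row where it is big. Each bucket then splits into small
    entries, whose signs are kept for cancellation, and mid entries, bounded by absolute values. *)
Lemma sketch_norm_le w : ~~ overload w -> sketch_norm w <= excess w.
Proof.
rewrite negb_exists => /forallP nbig; apply: ler_sum => r _.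
apply: ler_wpM2l; first by rewrite invr_ge0 rate_ge0.
rewrite {1}/bucket (bigID (is_small (row_level r))) /=.
apply: le_trans (ler_normD _ _) _; rewrite lerD2l.
apply: le_trans (ler_norm_sum _ _ _) _; rewrite /mid_load.
rewrite big_mkcond [leRHS]big_mkcond /=; apply: ler_sum => i _.
rewrite /is_mid; case: (is_small _ _) => //=.
rewrite !normrM normrX normrN1 expr1n mulr1 mulrC.
have := nbig i; case: eqP => [-> ->|_ _] /=; first by rewrite normr1.
by rewrite normr0 mulr0; case: ifP => // _; rewrite mulr0.
Qed.

(** Union bound over entries and levels: an entry big at level [h] is drawn there with probability
    at most [t * t^(-2h)], which is below [t^(1 - G) * |a_i|]. The [H.+1 <= t] levels cost one more
    factor [t]. *)
Lemma expect_overload_le : (H.+1)%:R <= t ->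
  E (fun w => (overload w)%:R) <= t ^+ 2 / t ^+ G.
Proof.
move=> Ht.
apply: (@le_trans _ _ (E (fun w => \sum_i (is_big (row_level (w i).1) i)%:R))).
  apply: ler_expect; first exact: outcome_prob_ge0.
  move=> w; case: (boolP (overload w)) => [/existsP[i bi]|_]; last exact: sumr_ge0.
  by rewrite (bigD1 i) //= bi lerDl sumr_ge0.
rewrite expect_sum.
apply: (@le_trans _ _ (\sum_i \sum_(h < H.+1) t / t ^+ G * `|a i|)).
  apply: ler_sum => i _.
  rewrite (expect_coord outcome_prob_sum1 i (fun o => (is_big (row_level o.1) i)%:R)).
  rewrite (mean_level (fun h => (is_big h i)%:R)); apply: ler_sum => h _.
  have tG : 0 <= t / t ^+ G * `|a i| by rewrite mulr_ge0 // divr_ge0 // ltW.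
  rewrite /is_big; case: ltP => [bi|_]; last by rewrite mulr0.
  rewrite mulr1 mulrAC ler_pdivlMr //.
  apply: (@le_trans _ _ (rt h * (`|a i| * t ^+ h.*2))).
    by rewrite ler_wpM2l ?rate_ge0 // ltW.
  by rewrite mulrCA mulrC ler_wpM2r // rate_mul_le.
have tG : 0 <= t / t ^+ G by rewrite divr_ge0 // ltW.
rewrite (eq_bigr (fun i => H.+1%:R * (t / t ^+ G) * `|a i|)); last first.
  by move=> i _; rewrite sumr_const card_ord -[LHS]mulr_natl mulrA.
rewrite -mulr_sumr; apply: le_trans (ler_piMr (mulr_ge0 (ler0n _ _) tG) a_sum) _.
by rewrite expr2 -mulrA ler_wpM2r.
Qed.

(** The random signs are centred, so only diagonal terms remain in the second moment, which is at
    most [rate h / N * t^-(2h + 6)]. *)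
Lemma expect_small_le r : (row_level r <= H)%N ->
  (rt (row_level r))^-1 * E (fun w => `|bucket r (is_small (row_level r)) w|)
    <= 3 / 2 / t ^+ 5.
Proof.
set h := row_level r => hH; have r0 : 0 < rt h by exact: rate_gt0.
(* This [c] balances the two terms of [expect_norm_le]: after division by the rate both are of order
   [t^-5]. *)
pose c := N%:R * t / rt h.
have c0 : 0 < c by rewrite divr_gt0 // mulr_gt0.
pose y i (o : 'I_k * bool) : R :=
  (o.1 == r)%:R * (-1) ^+ o.2 * (if is_small h i then a i else 0).
have bucketE w : bucket r (is_small h) w = \sum_i y i (w i).
  rewrite /bucket big_mkcond; apply: eq_bigr => i _.
  by rewrite /y; case: ifP; rewrite ?mulr0.
have sq : E (fun w => bucket r (is_small h) w ^+ 2) <= rt h / N%:R / t ^+ (h.*2 + 6).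
  rewrite (@eq_expect _ _ _ _ _ (fun w => (\sum_i y i (w i)) ^+ 2)); last first.
    by move=> w; rewrite bucketE.
  rewrite (expect_sqr_sum outcome_prob_sum1); last first.
    by move=> i; rewrite mean_signed_hit.
  apply: (@le_trans _ _ (\sum_i rt h / N%:R / t ^+ (h.*2 + 6) * `|a i|)).
    apply: ler_sum => i _.
    have -> : mean1 (fun o => y i o ^+ 2) =
        (if is_small h i then a i else 0) ^+ 2 * row_prob r.
      rewrite -mean_hit /mean mulr_sumr; apply: eq_bigr => o _.
      by rewrite /y !exprMn sqrr_sign mulr1 -natrX; case: eqP => _ /=; ring.
    rewrite mulrC /row_prob -/h -!mulrA; do 2![apply: ler_wpM2l; first by rewrite ?invr_ge0 ltW].
    rewrite /is_small; case: ifP => [si|_]; last first.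
      by rewrite expr0n mulr_ge0 // invr_ge0 ltW.
    rewrite -real_normK ?num_real // expr2 ler_wpM2r //.
    by rewrite -[_^-1]mul1r ler_pdivlMr.
  by rewrite -mulr_sumr ler_piMr // divr_ge0 ?(ltW (tX_gt0 _)) // divr_ge0 // ltW.
have cV : c^-1 = rt h / (N%:R * t) by rewrite /c invf_div.
apply: le_trans (ler_wpM2l _ (expect_norm_le outcome_prob_ge0 outcome_prob_sum1 _ c0)) _.
  by rewrite invr_ge0 ltW.
apply: (@le_trans _ _ ((rt h)^-1 * (2^-1 * (c * (rt h / N%:R / t ^+ (h.*2 + 6)) + c^-1)))).
  rewrite ler_wpM2l ?invr_ge0 ?(ltW r0) // ler_wpM2l // lerD2r.
  by rewrite ler_wpM2l // ltW.
have -> : (rt h)^-1 * (2^-1 * (c * (rt h / N%:R / t ^+ (h.*2 + 6)) + c^-1)) =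
    2^-1 * ((rt h)^-1 * (t / t ^+ (h.*2 + 6)) + (N%:R * t)^-1).
  by rewrite cV /c; field; rewrite !gt_eqF.
have tt : 0 <= t / t ^+ (h.*2 + 6) by rewrite divr_ge0 // ltW.
have := ler_wpM2r tt (rate_inv_le t_ge4 hH).
have -> : 2 * t ^+ h.*2 * (t / t ^+ (h.*2 + 6)) = 2 / t ^+ 5.
  by rewrite exprD; field; rewrite !gt_eqF.
by rewrite NE -exprSr; lra.
Qed.

(** Small entries cost [3 / 2 * t^-5] in each of at most [t * t^4] rows. A mid entry costs [|a_i|]
    in expectation at each level where it is mid, since sampling and rescaling cancel, and
    [level_count_le] allows [G + 6] such levels. *)
Lemma expect_excess_le : (H.+1)%:R <= t -> E excess <= (G + 8)%:R.
Proof.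
move=> Ht; rewrite /excess expect_sum.
pose F1 h : R := if (h <= H)%N then 3 / 2 / t ^+ 5 else 0.
pose F2 h : R := (rt h)^-1 * \sum_(i | is_mid h i) `|a i| * (rt h / N%:R).
apply: (@le_trans _ _ (\sum_(r < k) F1 (r %/ N)%N + \sum_(r < k) F2 (r %/ N)%N)).
  rewrite -big_split /=; apply: ler_sum => r _.
  rewrite expectZ expectD mulrDr lerD //.
    rewrite /F1 -/(row_level r); case: leqP => rH; first exact: expect_small_le.
    by rewrite rate_gtH // invr0 mul0r.
  rewrite /F2 -/(row_level r) ler_wpM2l ?invr_ge0 ?rate_ge0 //.
  rewrite /mid_load expect_sum; apply: ler_sum => i _.
  rewrite expectZ (expect_coord outcome_prob_sum1 i (fun o => (o.1 == r)%:R)).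
  by rewrite mean_hit.
rewrite (@sum_rows _ H) //; last by move=> h; rewrite /F1 ltnNge => /negPf ->.
rewrite (@sum_rows _ H) //; last by move=> h hH; rewrite /F2 rate_gtH // invr0 mul0r.
have -> : \sum_(h < H.+1) F1 h = H.+1%:R * (3 / 2 / t ^+ 5).
  rewrite (eq_bigr (fun=> 3 / 2 / t ^+ 5)); last first.
    by move=> h _; rewrite /F1 -ltnS ltn_ord.
  by rewrite sumr_const card_ord [RHS]mulr_natl.
have P1 : N%:R * (H.+1%:R * (3 / 2 / t ^+ 5)) <= 3 / 2.
  have -> : N%:R * (H.+1%:R * (3 / 2 / t ^+ 5)) = 3 / 2 * (H.+1%:R / t).
    by rewrite NE; field; rewrite gt_eqF.
  by rewrite ler_piMr // ler_pdivrMr // mul1r.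
suff P2 : N%:R * \sum_(h < H.+1) F2 h <= (G + 6)%:R.
  by have := lerD P1 P2; rewrite !natrD; lra.
have -> : N%:R * \sum_(h < H.+1) F2 h =
    \sum_i `|a i| * \sum_(h < H.+1) (is_mid h i)%:R.
  under [RHS]eq_bigr do rewrite mulr_sumr.
  rewrite exchange_big mulr_sumr /=; apply: eq_bigr => h _.
  have r0 : 0 < rt h by apply: rate_gt0 => //; rewrite -ltnS ltn_ord.
  rewrite /F2 big_mkcond !mulr_sumr; apply: eq_bigr => i _.
  case: (is_mid h i); last by rewrite !mulr0.
  by rewrite mulr1; field; rewrite !gt_eqF.
apply: (@le_trans _ _ (\sum_i `|a i| * (G + 6)%:R)); last first.
  by rewrite -mulr_suml ler_piMl.
apply: ler_sum => i _; rewrite ler_wpM2l //.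
apply: le_trans (level_count_le H t_ge4 G (normr_ge0 (a i))).
by apply: ler_sum => h _; rewrite /is_mid /is_small /is_big -ltNge -leNgt.
Qed.

End Sketch.

(** * Finitely supported laws on matrices *)

Section FiniteLaw.
Variables (R : realType) (disp : measure_display) (X : measurableType disp).
Variables (T : finType) (t0 : T) (q : T -> R) (S : T -> X).
Hypothesis q_ge0 : forall x, 0 <= q x.
Hypothesis q_sum1 : \sum_x q x = 1.

(** Assembled from [msum], [mscale] and [dirac] to inherit the measure structure. As [msum] is
    indexed by naturals, the points are read off [enum T], with [t0] as the default value of
    [nth]. *)
Definition finite_law : set X -> \bar R :=
  msum (fun i => mscale (NngNum (q_ge0 (nth t0 (enum T) i)))
                        (dirac (S (nth t0 (enum T) i)))) #|T|.

HB.instance Definition _ := Measure.on finite_law.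

Lemma finite_lawE (A : set X) : finite_law A = (\sum_x q x * (S x \in A)%:R)%:E.
Proof.
rewrite /finite_law /msum /=.
under eq_bigr do rewrite /mscale /= diracE -EFinM.
rewrite sumEFin; congr (_%:E).
rewrite -(big_mkord xpredT (fun i => q (nth t0 (enum T) i) *
  (S (nth t0 (enum T) i) \in A)%:R)) cardE.
by rewrite -(big_nth t0 xpredT (fun x => q x * (S x \in A)%:R)) big_enum.
Qed.

Let finite_law_setT : finite_law setT = 1%E.
Proof.
rewrite finite_lawE; congr (_%:E); rewrite -[RHS]q_sum1.
by apply: eq_bigr => x _; rewrite in_setT mulr1.
Qed.

HB.instance Definition _ :=
  Measure_isProbability.Build _ _ _ finite_law finite_law_setT.

Definition finite_prob : probability X R := finite_law.

End FiniteLaw.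

Lemma measurable_mx_set1 (R : realType) (m n : nat) (M : borel_mx R m n) :
  measurable [set M].
Proof.
have -> : [set M] = \bigcap_(i in [set: 'I_m]) \bigcap_(j in [set: 'I_n])
    [set M' : borel_mx R m n | M' i j = M i j].
  apply/seteqP; split => [_ -> //|M' MM' /=].
  by apply/matrixP => i j; exact: MM'.
apply: fin_bigcap_measurable => [|i _]; first exact: finite_finset.
apply: fin_bigcap_measurable => [|j _]; first exact: finite_finset.
by apply: sub_sigma_algebra; exists i, j, [set M i j].
Qed.

(** The finitely many atoms form a measurable set of full mass, so [P] itself may be
    nonmeasurable. *)
Lemma ae_finite_law (R : realType) (m n : nat) (T : finType) (t0 : T) (q : T -> R)
    (q_ge0 : forall x, 0 <= q x) (S : T -> borel_mx R m n) (P : borel_mx R m n -> Prop) :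
  (forall x, P (S x)) -> {ae finite_law t0 S q_ge0, forall M, P M}.
Proof.
move=> PS; exists (~` \bigcup_(x in [set: T]) [set S x]); split.
- apply: measurableC; apply: fin_bigcup_measurable => [|x _]; first exact: finite_finset.
  exact: measurable_mx_set1.
- rewrite finite_lawE big1 // => x _; rewrite memNset ?mulr0 //.
  by move=> /(_ _); apply; exists x.
- move=> M nP; move=> [x _] /= MS; apply: nP; rewrite MS; exact: PS.
Qed.

Lemma sketch_col_nnz (R : realType) (t : R) (N H k n : nat)
    (w : {ffun 'I_n -> 'I_k * bool}) (j : 'I_n) :
  (col_nnz (sketch t N H w) j <= 1)%N.
Proof.
rewrite /col_nnz -(cards1 (w j).1); apply: subset_leq_card; apply/fintype.subsetP => r.
rewrite !inE mxE; apply: contraR; rewrite eq_sym => /negPf ->.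
by rewrite !mul0r.
Qed.

(** * From one column to the whole matrix *)

Section MatrixSketch.
Variables (R : realType) (s t : R) (N H k n d : nat).
Hypothesis s_ge2 : 2 <= s.
Hypothesis tE : t = s ^+ 2.
Hypothesis NE : N%:R = t ^+ 4.
Hypothesis rows_le : (H.+1 * N <= k)%N.
Hypothesis n_le : n%:R <= t ^+ H.
Hypothesis H_le : H.+1%:R <= t.
Variables (G : nat) (delta : R).
Hypothesis delta_gt0 : 0 < delta.
Hypothesis s_delta : 20 <= s * delta.
Hypothesis G_delta : d%:R * (t ^+ 2 / t ^+ G) <= delta / 4.
Variable A : 'M[R]_(n, d).

Local Notation Omega := {ffun 'I_n -> 'I_k * bool}.
Local Notation E := (@expect R n _ (@outcome_prob R t N H k)).
Let p0 := outcome_prob_ge0 N H s_ge2 tE (k := k).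
Let p1 := outcome_prob_sum1 s_ge2 tE NE rows_le.

Definition col_mass j : R := \sum_i `|A i j|.
(* If the column vanishes, the junk value [x / 0 = 0] makes this [0]. *)
Definition unit_col j i : R := A i j / col_mass j.

Lemma col_mass_ge0 j : 0 <= col_mass j.
Proof. exact: sumr_ge0. Qed.

Lemma unit_colK j i : col_mass j * unit_col j i = A i j.
Proof.
rewrite /unit_col mulrC; have [m0|m0] := eqVneq (col_mass j) 0; last by rewrite divfK.
rewrite m0 mulr0; apply/esym/eqP; rewrite -normr_le0 -m0 /col_mass.
by rewrite (bigD1 i) //= lerDl sumr_ge0.
Qed.

(** The factor [col_mass j] keeps the identity valid for a zero column, whose unit column sums to
    [0]. *)
Lemma unit_col_sum j : col_mass j * \sum_i `|unit_col j i| = col_mass j.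
Proof.
rewrite mulr_sumr; apply: eq_bigr => i _.
by rewrite -{1}(ger0_norm (col_mass_ge0 j)) -normrM unit_colK.
Qed.

Lemma unit_col_sum_le1 j : \sum_i `|unit_col j i| <= 1.
Proof.
have [m0|m0] := eqVneq (col_mass j) 0.
  by rewrite big1 // => i _; rewrite /unit_col m0 invr0 mulr0 normr0.
by have := unit_col_sum j; rewrite -[RHS]mulr1 => /(mulfI m0) ->.
Qed.

Lemma l1normE : l1norm A = \sum_j col_mass j.
Proof. by rewrite /l1norm exchange_big. Qed.

Lemma l1norm_sketchE (w : Omega) :
  l1norm (sketch t N H w *m A) =
  \sum_j col_mass j * sketch_norm t N H (unit_col j) w.
Proof.
rewrite /l1norm exchange_big /=; apply: eq_bigr => j _.
rewrite /sketch_norm mulr_sumr; apply: eq_bigr => r _.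
have r0 : 0 <= (rate t H (row_level N r))^-1.
  by rewrite invr_ge0 rate_ge0 // tE; have := s_ge2; nra.
rewrite -{1}(ger0_norm (col_mass_ge0 j)) -(ger0_norm r0) -!normrM; congr `|_|.
rewrite mxE /bucket mulrCA !mulr_sumr; apply: eq_bigr => i _.
by rewrite mxE -[in LHS](unit_colK j i); ring.
Qed.

Let Z (w : Omega) := \sum_j col_mass j * deficit t N H (unit_col j) w.
Let U (w : Omega) := \sum_j col_mass j * excess t N H (unit_col j) G w.

Lemma sketch_good (w : Omega) :
  [forall j, ~~ overload t N (unit_col j) G w] ->
  l1norm A - Z w <= l1norm (sketch t N H w *m A) <= U w.
Proof.
move/forallP => ok; rewrite l1norm_sketchE l1normE /Z /U -sumrB.
apply/andP; split; apply: ler_sum => j _.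
  rewrite -{1}unit_col_sum -mulrBr ler_wpM2l ?col_mass_ge0 //.
  exact: (sketch_norm_ge _ s_ge2 tE (unit_col_sum_le1 j) n_le).
by rewrite ler_wpM2l ?col_mass_ge0 // (sketch_norm_le _ s_ge2 tE (ok j)).
Qed.

Definition embeds (w : Omega) : bool :=
  2^-1 * l1norm A <= l1norm (sketch t N H w *m A)
    <= 4 * (G + 8)%:R / delta * l1norm A.

(** Failure budget: Markov's inequality gives [10 / s <= delta / 2] for [Z] and [delta / 4] for [U];
    overloads over the [d] columns cost the last [delta / 4]. *)
Lemma embeds_prob : 1 - delta <= E (fun w => (embeds w)%:R).
Proof.
have M0 : 0 <= l1norm A by rewrite l1normE sumr_ge0 // => j _; exact: col_mass_ge0.
have EZ : E Z <= l1norm A * (5 / s).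
  rewrite expect_sum l1normE mulr_suml; apply: ler_sum => j _.
  rewrite expectZ ler_wpM2l ?col_mass_ge0 //.
  exact: (expect_deficit_le s_ge2 tE NE rows_le (unit_col_sum_le1 j)).
have EU : E U <= l1norm A * (G + 8)%:R.
  rewrite expect_sum l1normE mulr_suml; apply: ler_sum => j _.
  rewrite expectZ ler_wpM2l ?col_mass_ge0 //.
  exact: (expect_excess_le s_ge2 tE NE rows_le (unit_col_sum_le1 j)).
have Z0 w : 0 <= Z w.
  by apply: sumr_ge0 => j _; rewrite mulr_ge0 ?col_mass_ge0 // (deficit_ge0 _ _ s_ge2 tE).
have U0 w : 0 <= U w.
  by apply: sumr_ge0 => j _; rewrite mulr_ge0 ?col_mass_ge0 // (excess_ge0 _ _ s_ge2 tE).
(* Markov's inequality needs a positive threshold, so norm [0] is treated apart. *)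
move: M0; rewrite le_eqVlt => /predU1P[M0|M0].
  have cm j : col_mass j = 0.
    apply/eqP; rewrite eq_le col_mass_ge0 andbT M0 l1normE (bigD1 j) //= lerDl.
    by apply: sumr_ge0 => i _; exact: col_mass_ge0.
  rewrite (@eq_expect _ _ _ _ _ (fun=> 1)) ?expect_cst //.
    by rewrite gerBl ltW.
  move=> w; rewrite /embeds -M0 !mulr0 l1norm_sketchE big1 ?lexx //.
  by move=> j _; rewrite cm mul0r.
have s0 : 0 < s by apply: lt_le_trans s_ge2.
have G0 : 0 < (G + 8)%:R :> R by rewrite ltr0n addnS.
pose u := 4 * (G + 8)%:R / delta * l1norm A.
have u0 : 0 < u by rewrite !mulr_gt0 ?invr_gt0.
have PZ := markov_expect p0 (mulr_gt0 (_ : 0 < 2^-1) M0) Z0.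
have PU := markov_expect p0 u0 U0.
have PO : E (fun w => \sum_j (overload t N (unit_col j) G w)%:R) <= delta / 4.
  apply: le_trans G_delta; rewrite expect_sum.
  have -> : d%:R * (t ^+ 2 / t ^+ G) = \sum_(j < d) t ^+ 2 / t ^+ G.
    by rewrite sumr_const card_ord mulr_natl.
  apply: ler_sum => j _.
  exact: (expect_overload_le s_ge2 tE NE rows_le (unit_col_sum_le1 j)).
have PZ' : E (fun w => (2^-1 * l1norm A < Z w)%R%:R) <= delta / 2.
  apply: le_trans (PZ _) _; first by rewrite invr_gt0.
  rewrite ler_pdivrMr ?mulr_gt0 ?invr_gt0 //; apply: le_trans EZ _.
  rewrite mulrA ler_pdivrMr //.
  have := ler_wpM2l (ltW M0) s_delta; lra.
have PU' : E (fun w => (u < U w)%R%:R) <= delta / 4.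
  apply: le_trans PU _; rewrite ler_pdivrMr //; apply: le_trans EU _.
  by rewrite /u le_eqVlt; apply/predU1P; left; field; rewrite gt_eqF.
(* The union bound, as a pointwise inequality between indicators. *)
have : E (fun=> 1) <= E (fun w => (embeds w)%:R +
    ((2^-1 * l1norm A < Z w)%R%:R + ((u < U w)%R%:R +
     \sum_j (overload t N (unit_col j) G w)%:R))).
  apply: (ler_expect p0) => w.
  have O0 : 0 <= \sum_j (overload t N (unit_col j) G w)%:R :> R by exact: sumr_ge0.
  have b0 (b : bool) : 0 <= b%:R :> R by [].
  have := b0 (embeds w); have := b0 (2^-1 * l1norm A < Z w); have := b0 (u < U w).
  case: (boolP [forall j, ~~ overload t N (unit_col j) G w]) => [ok|/forallPn[j]].
    have /andP[lo hi] := sketch_good ok.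
    case: (ltP (2^-1 * l1norm A)) => [_|ZM] /=; first by lra.
    case: (ltP u) => [_|UM] /=; first by lra.
    suff -> : embeds w by rewrite /=; lra.
    rewrite /embeds; apply/andP; split; last exact: le_trans UM.
    by apply: le_trans lo; lra.
  rewrite negbK => oj.
  have : 1 <= \sum_j (overload t N (unit_col j) G w)%:R :> R.
    by rewrite (bigD1 j) //= oj lerDl sumr_ge0.
  by lra.
by rewrite expect_cst // !expectD; lra.
Qed.

End MatrixSketch.

(** * Numerical bounds and choice of parameters *)

Lemma ln_ge_half (R : realType) (n : nat) : (1 < n)%N -> 2^-1 <= ln n%:R :> R.
Proof.
move=> n1; have n0 : 0 < n%:R :> R by rewrite ltr0n; lia.
rewrite -[leLHS]expRK ler_ln ?posrE ?expR_gt0 //.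
apply: (@le_trans _ _ 2); last by rewrite ler_nat.
have := expR_ge1Dx (- 2^-1 : R); rewrite expRN => e.
by rewrite -lef_pV2 ?posrE ?expR_gt0 //; lra.
Qed.

(** Since [ln 2 >= 1/2], the binary logarithm is at most [2 ln n]; since [ln n >= 1/2], the additive
    [2] is at most [4 ln n]. *)
Lemma trunc_log_le_ln (R : realType) (n : nat) : (1 < n)%N ->
  (trunc_log 2 n).+2%:R <= 6 * ln n%:R :> R.
Proof.
move=> n1; have n0 : (0 < n)%N by lia.
have L := ln_ge_half R n1; have L2 := ln_ge_half R (isT : (1 < 2)%N).
have : (trunc_log 2 n)%:R * ln 2 <= ln n%:R :> R.
  rewrite mulr_natl -lnXn ?ltr0n // ler_ln ?posrE ?exprn_gt0 ?ltr0n //.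
  by rewrite -natrX ler_nat trunc_logP.
have -> : (trunc_log 2 n).+2%:R = (trunc_log 2 n)%:R + 2 :> R.
  by rewrite -natrD addn2.
have := ler_wpM2l (ler0n R (trunc_log 2 n)) L2.
by lra.
Qed.

Lemma abs_ceilP (R : realType) (x : R) : 0 <= x ->
  [/\ (`|Num.ceil x|%N)%:Z = Num.ceil x, x <= (`|Num.ceil x|%N)%:R
    & (`|Num.ceil x|%N)%:R <= x + 1].
Proof.
move=> x0; have c0 : 0 <= Num.ceil x by rewrite ceil_ge0 (lt_le_trans _ x0) // ltrN10.
have E : (`|Num.ceil x|%N)%:R = (Num.ceil x)%:~R :> R.
  by rewrite -[in RHS](gez0_abs c0).
split; rewrite ?gez0_abs // E ?ceil_ge //.
by have /andP[+ _] := ceil_itv x; rewrite intrB; lra.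
Qed.

Lemma law_of_sketches (R : realType) (k n d : nat) (c1 c2 delta : R) (T : finType)
    (t0 : T) (q : T -> R) (S : T -> 'M[R]_(k, n)) :
  (1 < n)%N -> (forall x, 0 <= q x) -> \sum_x q x = 1 ->
  (forall x j, (col_nnz (S x) j <= 1)%N) ->
  (forall A : 'M[R]_(n, d), 1 - delta <= \sum_x q x *
     (c1 * l1norm A <= l1norm (S x *m A) <= c2 * l1norm A)%R%:R) ->
  exists D : probability (borel_mx R k n) R,
    {ae D, forall M : 'M[R]_(k, n), sparse_mx 2 M} /\
    forall A : 'M[R]_(n, d), ((1 - delta)%:E <= D [set M : 'M[R]_(k, n) |
      (c1 * l1norm A <= l1norm (M *m A) <= c2 * l1norm A)%R])%E.
Proof.
move=> n1 q0 q1 nnz good.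
exists (finite_prob t0 (S : T -> borel_mx R k n) q0 q1); split.
  apply: ae_finite_law => x j.
  (* The sparsity constant [2] comes from [ln n >= 1/2]. *)
  apply: (@le_trans _ _ 1); first by rewrite lern1 nnz.
  by have := ln_ge_half R n1; lra.
move=> A; rewrite [leRHS]finite_lawE lee_fin; apply: le_trans (good A) _.
apply: ler_sum => x _; rewrite ler_wpM2l // ler_nat.
case: (boolP (_ <= _ <= _)) => // ok.
by rewrite mem_set.
Qed.

(** Here [h] is the number of levels, [s^8] the number of buckets per level, [e] is [1 / delta] and
    [L] is [ln n]. The product [h * h^8] gives degree [9] in [L]; the factor [2^-1] is a lower bound
    for [(e L)^alpha]. *)
Lemma sketch_rows_bound (R : realType) (D e L K h s : R) :
  0 <= D -> 0 <= e -> 0 <= h -> 0 <= s -> h <= 6 * L ->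
  s <= 2 * (D * (20 * e) * h) ->
  2^-1 * D ^+ 8 * (2 * 40 ^+ 8 * 6 ^+ 9 * L ^+ 9 * e ^+ 8) <= K ->
  h * s ^+ 8 <= K.
Proof.
move=> D0 e0 h0 s0 hL sx; apply: le_trans.
apply: (@le_trans _ _ (h * (2 * (D * (20 * e) * h)) ^+ 8)).
  by rewrite ler_wpM2l // lerXn2r ?nnegrE // (le_trans s0).
have -> : h * (2 * (D * (20 * e) * h)) ^+ 8 =
    (D ^+ 8 * 40 ^+ 8 * e ^+ 8) * h ^+ 9.
  have -> : 2 * (D * (20 * e) * h) = D * 40 * e * h by ring.
  by rewrite !exprMn [h ^+ 9]exprS; ring.
have -> : 2^-1 * D ^+ 8 * (2 * 40 ^+ 8 * 6 ^+ 9 * L ^+ 9 * e ^+ 8) =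
    (D ^+ 8 * 40 ^+ 8 * e ^+ 8) * (6 * L) ^+ 9.
  rewrite [(6 * L) ^+ 9]exprMn.
  move: (40 ^+ 8) (6 ^+ 9) (D ^+ 8) (L ^+ 9) (e ^+ 8) => x1 x2 x3 x4 x5.
  by field.
rewrite ler_wpM2l ?mulr_ge0 ?exprn_ge0 // lerXn2r ?nnegrE //.
exact: le_trans hL.
Qed.

(* c1 : constant of Omega(1); c2 : constant of O(1/(delta alpha));
   c3 : constant of the O(log n) column sparsity; p : the polynomial poly.
   All four are absolute. *)
Theorem theorem4p2 (R : realType) :
  exists (c1 c2 c3 : R) (p : {poly {poly R}}),
    [/\ 0 < c1, 0 < c2 & 0 < c3] /\
    forall (delta alpha : R) (n d : nat),
      0 < delta < 1 -> 0 < alpha < 1 -> (1 < n)%N ->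
      exists k : nat,
        k%:Z = Num.ceil ((d%:R / delta * ln n%:R) `^ alpha
                         * p.[(delta^-1)%:P].[ln n%:R]) /\
        exists D : probability (borel_mx R k n) R,
          {ae D, forall S : 'M[R]_(k, n), sparse_mx c3 S} /\
          forall A : 'M[R]_(n, d),
            ((1 - delta)%:E <=
             D [set S : 'M[R]_(k, n) |
                 (c1 * l1norm A <= l1norm (S *m A)
                    <= c2 / (delta * alpha) * l1norm A)%R])%E.
Proof.
(* The polynomial is the one of [sketch_rows_bound]: [40 = 2 * 20] from rounding and
   [s * delta >= 20], and [6] from [trunc_log_le_ln]. *)
exists 2^-1, 64, 2, (((2 * 40 ^+ 8 * 6 ^+ 9 : R) *: 'X^9)%:P * 'X^8).
split=> [|delta alpha n d /andP[de0 de1] /andP[al0 al1] n1]; first by split; rewrite ?invr_gt0.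
set K := (X in Num.ceil X).
set L : R := ln n%:R in K *.
have L2 : 2^-1 <= L := ln_ge_half R n1.
have L0 : 0 < L by apply: lt_le_trans L2.
have KE : K = (d%:R / delta * L) `^ alpha *
    (2 * 40 ^+ 8 * 6 ^+ 9 * L ^+ 9 * delta^-1 ^+ 8).
  by rewrite /K hornerM hornerC hornerXn hornerM hornerZ hornerXn horner_exp hornerC.
have e0 : 0 < delta^-1 by rewrite invr_gt0.
have K0 : 0 <= K by rewrite KE !mulr_ge0 ?powR_ge0 ?exprn_ge0 ?ltW.
have [kE Kk _] := abs_ceilP K0.
exists `|Num.ceil K|%N; split=> //; move: Kk; set k := `|Num.ceil K|%N => Kk.
(* Without columns all norms are [0] and the zero matrix serves; the general case uses [1 <= d]. *)
have [d0|d0] := posnP d.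
  apply: (@law_of_sketches _ _ _ _ _ _ _ unit tt (fun=> 1) (fun=> 0)) => //.
  - by rewrite big_const card_unit /= addr0.
  - by move=> _ j; rewrite /col_nnz eq_card0 // => i; rewrite !inE mxE eqxx.
  - move=> A; have l0 m (M : 'M[R]_(m, d)) : l1norm M = 0.
      rewrite /l1norm big1 // => i _; rewrite big1 // => j _.
      by have := ltn_ord j; rewrite {2}d0.
    rewrite !l0 !mulr0 lexx big_const card_unit /= addr0 mulr1.
    by rewrite gerBl ltW.
have dR1 : 1 <= d%:R :> R by rewrite ler1n.
(* The exponent makes [D^8 = d^alpha], the cost in rows of [N = s^8], while
   [t >= D^2 = d^(alpha/4)]. *)
pose D : R := d%:R `^ (alpha / 8).
have D1 : 1 <= D.
  by rewrite -(powRr0 d%:R); apply: ler_powR => //; rewrite divr_ge0 // ltW.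
have D0 : 0 < D by apply: lt_le_trans D1.
pose H := (trunc_log 2 n).+1.
have HL : H.+1%:R <= 6 * L by exact: trunc_log_le_ln.
have H1 : 1 <= H.+1%:R :> R by rewrite ler1n.
(* All three factors are at least [1], so [s >= x] dominates each of them. *)
pose x := D * (20 * delta^-1) * H.+1%:R.
have e1 : 1 <= delta^-1 by rewrite invf_ge1 // ltW.
have De : 20 * delta^-1 <= D * (20 * delta^-1).
  by rewrite ler_peMl // mulr_ge0 // ltW.
have x_e : 20 * delta^-1 <= x.
  by apply: le_trans De _; rewrite ler_peMr // !mulr_ge0 ?ltW.
have x_H : H.+1%:R <= x.
  by rewrite ler_peMl //; apply: le_trans De; lra.
have x_D : D <= x.
  rewrite /x -mulrA ler_peMr ?(ltW D0) //.
  by apply: le_trans (ler_peMr _ H1); [lra | rewrite mulr_ge0 // ltW].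
have x0 : 0 <= x by apply: le_trans x_e; rewrite mulr_ge0 // ltW.
have [_ xs sx] := abs_ceilP x0.
pose sN := `|Num.ceil x|%N; pose s : R := sN%:R; pose t := s ^+ 2.
rewrite -/sN -/s in xs sx.
have s_2x : s <= 2 * x by lra.
have s_ge2 : 2 <= s by lra.
have s0 : 0 < s by lra.
have t_ge4 : 4 <= t by rewrite /t; nra.
have st : s <= t by rewrite /t; nra.
pose N := (sN ^ 8)%N.
have NE : N%:R = t ^+ 4 by rewrite /N /t natrX -exprM.
have rows : (H.+1 * N <= k)%N.
  rewrite -(ler_nat R) natrM NE /t -exprM; apply: le_trans Kk.
  apply: (sketch_rows_bound (ltW D0) (ltW e0) _ (ltW s0) HL) => //.
  rewrite KE ler_wpM2r //.
    by rewrite !mulr_ge0 ?exprn_ge0 // ltW.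
  have -> : D ^+ 8 = d%:R `^ alpha.
    by rewrite /D -powR_mulrn ?powR_ge0 // -powRrM divfK.
  have eL : 0 <= delta^-1 * L by rewrite mulr_ge0 // ltW.
  rewrite -[d%:R / delta * L]mulrA powRM // mulrC ler_wpM2l ?powR_ge0 //.
  (* As [alpha < 1], [(L / delta)^alpha >= 2^(-alpha) >= 1/2]. *)
  apply: (@le_trans _ _ (2^-1 `^ alpha)).
    by apply: ger1_powR; [apply/andP; split; lra | exact: ltW].
  apply: ge0_ler_powR; rewrite ?nnegrE ?(ltW al0) //.
  by apply: le_trans L2 _; rewrite ler_peMl // ltW.
have n_le : n%:R <= t ^+ H.
  apply: (@le_trans _ _ (2 ^+ H)).
    by rewrite -natrX ler_nat ltnW // trunc_log_ltn.
  by rewrite lerXn2r ?nnegrE //; lra.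
have H_le : H.+1%:R <= t by lra.
have a4 : 0 <= 4 / alpha by rewrite divr_ge0 // ltW.
have [_ ga ga1] := abs_ceilP a4.
move: ga ga1; set g := `|_|%N => ga ga1.
(* With [g >= 4 / alpha], [t^g >= d^(g alpha / 4) >= d]. *)
have tg : d%:R <= t ^+ g.
  apply: (@le_trans _ _ ((D ^+ 2) ^+ g)); last first.
    by rewrite lerXn2r ?nnegrE ?exprn_ge0 // /t ?lerXn2r ?nnegrE //; lra.
  rewrite /D -exprM -powR_mulrn ?powR_ge0 // -powRrM -{1}[d%:R]powRr1 //.
  apply: ler_powR => //; rewrite natrM.
  have -> : alpha / 8 * (2 * g%:R) = g%:R * (alpha / 4) by field.
  rewrite -ler_pdivrMr ?divr_gt0 // mul1r invf_div; exact: ga.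
(* Beyond [g], two powers of [t] cancel [t^2] and the third supplies [1 / t <= delta / 4]. *)
have G_delta : d%:R * (t ^+ 2 / t ^+ (3 + g)) <= delta / 4.
  have tg0 : 0 < t ^+ g by rewrite exprn_gt0 //; lra.
  have -> : d%:R * (t ^+ 2 / t ^+ (3 + g)) = (d%:R / t ^+ g) / t.
    by rewrite exprD; field; rewrite !gt_eqF //; lra.
  apply: (@le_trans _ _ (t^-1)).
    rewrite ler_piMl ?invr_ge0 //; first lra.
    by rewrite ler_pdivrMr // mul1r.
  rewrite -[delta / 4]invrK invf_div lef_pV2 ?posrE ?divr_gt0 //; lra.
have s_delta : 20 <= s * delta by rewrite -ler_pdivrMr // (le_trans x_e).
have p0 := outcome_prob_ge0 N H s_ge2 (erefl t) (k := k).
have p1 := outcome_prob_sum1 s_ge2 (erefl t) NE rows.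
have k0 : (0 < k)%N.
  apply: leq_trans rows; rewrite muln_gt0 /= expn_gt0 -(ltr0n R) -/s.
  by rewrite s0.
apply: (@law_of_sketches _ _ _ _ _ _ _ _ [ffun=> (Ordinal k0, true)]
   (prodw (@outcome_prob R t N H k)) (@sketch R t N H k n)) => //.
- exact: prodw_ge0.
- exact: sum_prodw.
- by move=> w j; exact: sketch_col_nnz.
move=> A.
apply: le_trans (embeds_prob s_ge2 (erefl t) NE rows n_le H_le de0 s_delta G_delta A) _.
apply: ler_sum => w _; rewrite ler_wpM2l ?prodw_ge0 // ler_nat.
rewrite /embeds; case: (boolP (_ <= _ <= _)) => // /andP[lo hi].
rewrite lo /=; suff -> : l1norm (sketch t N H w *m A) <= 64 / (delta * alpha) * l1norm A by [].
apply: le_trans hi _; apply: ler_wpM2r; first by do 2!apply: sumr_ge0 => ? _.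
have b1 : 1 <= alpha^-1 by rewrite invf_ge1 // ltW.
(* From [g <= 4 / alpha + 1] the left side is at most [16 / alpha + 48], whence [64]. *)
have gb : 4 * (3 + g + 8)%:R <= 64 * alpha^-1 by rewrite !natrD; lra.
have := ler_wpM2r (ltW e0) gb.
by rewrite invfM; lra.
Qed.
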